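(* Let $k\geq 1$, $p\geq 3$ and $q\geq p-1$ be integers. Then for every integer $n\geq p$ there is no Gallai-$k$-coloring of $K_n$ in which every copy of $K_p$ receives at least $q+1$ distinct colors. Consequently $g^k_q(p)=p$.
   Context: A Gallai-$k$-coloring of the complete graph $K_n$ is a map $c:E(K_n)\to\{1,\dots,k\}$ (not necessarily surjective) with no rainbow triangle, i.e. every triangle receives at most two distinct colors. For integers $k,p,q\ge 1$, $g^k_q(p)$ denotes the smallest positive integer $n$ such that every Gallai-$k$-coloring of $K_n$ contains a copy of $K_p$ whose edges receive at most $q$ distinct colors. (The paper defines $g^k_q(p)$ for $1\le q\le\binom p2$; the same definition makes sense for larger $q$.) *)

(* Defs.v *)
From mathcomp Require Import all_boot.

Set Implicit Arguments.
Unset Strict Implicit.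
Unset Printing Implicit Defensive.

(* K_n has vertex set 'I_n; its edges are the 2-element vertex sets. *)
Notation edge n := {e : {set 'I_n} | #|e| == 2}.

Definition coloring (n k : nat) : Type := edge n -> 'I_k.

(* A copy of K_p in K_n is determined by its p-element vertex set S. *)
Definition colors_on (n k : nat) (c : coloring n k) (S : {set 'I_n}) :
    {set 'I_k} :=
  [set c e | e : edge n & val e \subset S].

Definition gallai (n k : nat) (c : coloring n k) : Prop :=
  forall T : {set 'I_n}, #|T| = 3 -> #|colors_on c T| <= 2.

Definition forces (k q p n : nat) : Prop :=
  forall c : coloring n k, gallai c ->
    exists S : {set 'I_n}, #|S| = p /\ #|colors_on c S| <= q.

(* g^k_q(p) = n.  A relation, because totality of g is a Ramsey-type theorem. *)
Definition gallai_number (k q p n : nat) : Prop :=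
  [/\ 0 < n, forces k q p n & forall m, 0 < m -> forces k q p m -> n <= m].

Lemma gallai_number_uniq (k q p n m : nat) :
  gallai_number k q p n -> gallai_number k q p m -> n = m.
Proof.
move=> [n0 fn ln] [m0 fm lm].
by apply/eqP; rewrite eqn_leq ln ?lm.
Qed.

(* Main.v *)
Require Import Defs.
From mathcomp Require Import all_boot.

(** A Gallai coloring shows fewer colors than vertices on every nonempty vertex
    set S ([card_colors_on_gallai]).  The reason is that deleting a vertex v
    from S destroys at most one color ([card_lost_colors]): if two distinct
    colors disappeared, both would occur only on edges at v, say on vx and vy;
    the edge xy survives the deletion, so it has a third color, and v, x, y
    span a rainbow triangle.  Induction on #|S| gives the bound, the base case
    being a single vertex, which spans no edge.

    Every p-set thus receives at most p - 1 <= q colors, which rules out the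
    colorings of the first claim and shows that p vertices suffice.  Fewer do
    not: a constant coloring is Gallai, but there is no p-set to be found. *)

Lemma mem_colors_on n k (c : coloring n k) (S : {set 'I_n}) (e : edge n) :
  val e \subset S -> c e \in colors_on c S.
Proof. by move=> eS; apply/imsetP; exists e; rewrite ?inE. Qed.

Lemma lost_color_edge {n k} {c : coloring n k} {S : {set 'I_n}} {v i} :
  i \in colors_on c S :\: colors_on c (S :\ v) ->
  exists x (e : edge n), [/\ x \in S :\ v, val e = [set v; x] & c e = i].
Proof.
case/setDP=> /imsetP[e]; rewrite inE => eS -> lost.
have ve : v \in val e.
  apply: contraR lost => ve; apply: mem_colors_on.
  by rewrite subsetD1 eS.
have /cards2P[a [b [ab E]]] := valP e.
have [aS bS] : a \in S /\ b \in S.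
  by split; apply: (subsetP eS); rewrite E !inE eqxx ?orbT.
move: ve; rewrite E !inE => /orP[] /eqP vE.
  by exists b, e; rewrite !inE vE eq_sym ab bS.
by exists a, e; rewrite !inE vE ab aS setUC.
Qed.

(** Two colors lost with v would form a rainbow triangle together with the
    color of the surviving edge opposite to v. *)
Lemma card_lost_colors {n k} {c : coloring n k} (S : {set 'I_n}) v :
  gallai c -> #|colors_on c S :\: colors_on c (S :\ v)| <= 1.
Proof.
move=> gc; apply/card_le1_eqP => j i jL iL.
have [x [e [xS Ee ci]]] := lost_color_edge iL.
have [y [f [yS Ef cj]]] := lost_color_edge jL.
apply/eqP/negPn/negP => ij.
have xy : x != y.
  apply: contraNneq ij => xy; apply/eqP; rewrite -ci -cj.
  by congr c; apply: val_inj; rewrite Ee Ef xy.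
have Pg : #|[set x; y]| == 2 by rewrite cards2 xy.
pose g : edge n := exist _ [set x; y] Pg.
have gS : c g \in colors_on c (S :\ v).
  by apply: mem_colors_on; rewrite subUset !sub1set xS.
have survives t : t \in colors_on c S :\: colors_on c (S :\ v) -> c g != t.
  by case/setDP=> _; apply: contraNneq => <-.
have T3 : #|c g |: [set i; j]| = 3.
  by rewrite cardsU1 cards2 ij !inE negb_or !survives.
have V3 : #|v |: [set x; y]| = 3.
  move: xS yS; rewrite cardsU1 cards2 xy !inE negb_or ![v == _]eq_sym.
  by move=> /andP[-> _] /andP[-> _].
have : c g |: [set i; j] \subset colors_on c (v |: [set x; y]).
  rewrite !subUset !sub1set -ci -cj !mem_colors_on ?Ee ?Ef //=;
    by rewrite subUset !sub1set !inE !eqxx ?orbT.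
by move/subset_leq_card; rewrite T3 leqNgt ltnS gc.
Qed.

Theorem card_colors_on_gallai n k (c : coloring n k) (S : {set 'I_n}) :
  gallai c -> S != set0 -> #|colors_on c S| < #|S|.
Proof.
move=> gc; move: {2}#|S| (erefl #|S|) => m.
elim: m S => [|m IH] S Sm; first by rewrite -card_gt0 Sm.
case/set0Pn=> v vS.
have Dm : #|S :\ v| = m by move: Sm; rewrite (cardsD1 v) vS => -[].
have [D0 | Dn0] := eqVneq (S :\ v) set0.
  suff -> : colors_on c S = set0 by rewrite cards0 Sm.
  apply/setP => i; rewrite in_set0; apply/imsetP => -[e].
  rewrite inE => /subset_leq_card.
  by rewrite (eqP (valP e)) Sm -Dm D0 cards0.
rewrite Sm ltnS -(cardsID (colors_on c (S :\ v)) (colors_on c S)).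
apply: leq_trans (leq_add (subset_leq_card (subsetIr _ _))
                          (card_lost_colors S v gc)) _.
by rewrite addn1 -[leqRHS]Dm IH.
Qed.

Lemma gallai_const {n k} (i : 'I_k) : gallai (fun _ : edge n => i).
Proof.
move=> T _; apply: (@leq_trans #|[set i]|); last by rewrite cards1.
by apply/subset_leq_card/subsetP => j /imsetP[e _ ->]; rewrite inE.
Qed.

Theorem corollary1p2 (k p q : nat) (hk : 1 <= k) (hp : 3 <= p)
    (hq : p - 1 <= q) :
  (forall n : nat, p <= n ->
     ~ (exists c : coloring n k,
          gallai c /\
          forall S : {set 'I_n}, #|S| = p -> q + 1 <= #|colors_on c S|)) /\
  gallai_number k q p p.
Proof.
have p0 : 0 < p by apply: leq_trans hp.
have few n (c : coloring n k) (S : {set 'I_n}) :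
    gallai c -> #|S| = p -> #|colors_on c S| <= q.
  move=> gc Sp; apply: leq_trans hq; rewrite subn1 -ltnS prednK // -Sp.
  by apply: card_colors_on_gallai; rewrite // -card_gt0 Sp.
split=> [n pn [c [gc many]] | ].
  have : p <= #|[set: 'I_n]| by rewrite cardsT card_ord.
  case/card_geqP=> s [us sp _].
  have Sp : #|[set x in s]| = p by rewrite cardsE (card_uniqP us).
  by have := leq_trans (many _ Sp) (few _ _ _ gc Sp); rewrite addn1 ltnn.
split=> // [c gc | m _ /(_ _ (gallai_const (Ordinal hk)))[S [<- _]]].
  have Tp : #|[set: 'I_p]| = p by rewrite cardsT card_ord.
  by exists [set: 'I_p]; split; last exact: few.
by rewrite -[leqRHS]card_ord max_card.
Qed.
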